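(* Let $N>1$ be an integer, let $(X,\mu)$ be a nonatomic probability space and let $\mathcal{T}$ be an $N$-homogeneous tree-like family on $X$. Let $q>p>1$ and let $F,f>0$ be real numbers with $f^{p}\leq F$. Write $c(N,p)=\frac{p-1}{p}\cdot\frac{N^{p}-1}{N^{p}-N}$. Then for every measurable $\phi\geq0$ on $X$ with $\int_{X}\phi\,d\mu=f$ and $\int_{X}\phi^{p}\,d\mu=F$ the following hold. (i) If $\frac{q-1}{q-p}\cdot\frac{f^{p}}{F}<1$, then $$\|M_{\mathcal{T}}\phi\|_{q,\infty}\geq\max\left[c(N,p)^{1/q}\,\frac{(q-p)^{(q-p)/(q(p-1))}}{(q-1)^{(q-1)/(q(p-1))}}\left(\frac{F^{\frac{q-1}{p-1}}}{f^{\frac{q-p}{p-1}}}\right)^{1/q},\ \left(f^{p}+\frac{N^{p}-1}{N^{p}-N}(F-f^{p})\right)^{1/p}\right].$$ (ii) If $\frac{q-1}{q-p}\cdot\frac{f^{p}}{F}\geq1$, then $$\|M_{\mathcal{T}}\phi\|_{q,\infty}\geq\max\left[c(N,p)^{1/q}\left(\frac{p}{p-1}\right)^{1/p}\left(F-\frac{f^{p}}{p}\right)^{1/p},\ \left(f^{p}+\frac{N^{p}-1}{N^{p}-N}(F-f^{p})\right)^{1/p}\right].$$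
   Context: Let $(X,\mu)$ be a nonatomic probability space and $N>1$ an integer. A set $\mathcal{T}$ of measurable subsets of $X$ is called an $N$-homogeneous tree-like family if: (i) $X\in\mathcal{T}$, and to every $I\in\mathcal{T}$ there corresponds a finite subset $\mathcal{C}(I)\subseteq\mathcal{T}$ containing $N$ elements, each of measure $N^{-1}\mu(I)$, which are pairwise disjoint subsets of $I$ with $I=\bigcup\mathcal{C}(I)$; (ii) $\mathcal{T}=\bigcup_{m\geq0}\mathcal{T}_{(m)}$, where $\mathcal{T}_{(0)}=\{X\}$ and $\mathcal{T}_{(m+1)}=\bigcup_{I\in\mathcal{T}_{(m)}}\mathcal{C}(I)$; (iii) $\mathcal{T}$ differentiates $L^{1}(X,\mu)$, i.e. for every $\psi\in L^1(X,\mu)$ and $\mu$-almost every $x$, the averages $\frac{1}{\mu(I)}\int_I\psi\,d\mu$ over $I\in\mathcal{T}_{(m)}$ with $x\in I$ converge to $\psi(x)$ as $m\to\infty$. The associated maximal operator is $M_{\mathcal{T}}\psi(x)=\sup\left\{\frac{1}{\mu(I)}\int_{I}|\psi|\,d\mu: x\in I\in\mathcal{T}\right\}$ for $\psi\in L^{1}(X,\mu)$. For $q>p>1$ and measurable $\psi$ on $X$, the (weak $L^q$-equivalent) norm, depending also on $p$, is $$\|\psi\|_{q,\infty}=\sup_{\mu(E)>0}\mu(E)^{-\frac{1}{p}+\frac{1}{q}}\left(\int_{E}|\psi|^{p}\,d\mu\right)^{1/p},$$ the supremum being over all measurable $E\subseteq X$ with $\mu(E)>0$ (the value $+\infty$ is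 allowed). *)

(* Defs.v *)
From HB Require Import structures.
From mathcomp Require Import all_boot all_order all_algebra.
From mathcomp Require Import all_classical all_reals all_analysis.

Set Implicit Arguments.
Unset Strict Implicit.
Unset Printing Implicit Defensive.

Import Order.TTheory GRing.Theory Num.Theory.
Import numFieldNormedType.Exports.

Local Open Scope classical_set_scope.
Local Open Scope ring_scope.

Definition nonatomic d (X : measurableType d) (R : realType)
    (mu : probability X R) : Prop :=
  forall A : set X, measurable A -> (0 < mu A)%E ->
  exists B : set X,
    [/\ measurable B, B `<=` A, (0 < mu B)%E & (mu B < mu A)%E].

Fixpoint tree_level (X : Type) (C : set X -> set (set X)) (m : nat) :
    set (set X) :=
  match m with
  | 0%N => [set [set: X]]
  | m'.+1 => \bigcup_(I in tree_level C m') C I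
  end.

(* The levels partition X, so for every x exactly one sequence I satisfies
   the premise below, and the conclusion is convergence along the sets of
   the levels that contain x. *)
Definition differentiates_L1 d (X : measurableType d) (R : realType)
    (mu : probability X R) (lev : nat -> set (set X)) : Prop :=
  forall psi : X -> R, mu.-integrable [set: X] (EFin \o psi) ->
  {ae mu, forall x : X, forall I : nat -> set X,
    (forall m, lev m (I m) /\ I m x) ->
    (fine (mu (I m)))^-1 * Rintegral mu (I m) psi @[m --> \oo] --> psi x}.

(* C is the assignment of children; its values outside T are irrelevant. *)
Definition homogeneous_tree d (X : measurableType d) (R : realType)
    (mu : probability X R) (N : nat) (T : set (set X)) : Prop :=
  [/\ forall I, T I -> measurable I,
      T [set: X] &
      exists C : set X -> set (set X),
      [/\ forall I, T I ->
            [/\ C I `<=` T,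
                (C I #= `I_N)%card,
                forall J, C I J -> mu J = ((N%:R^-1)%:E * mu I)%E,
                trivIset (C I) id &
                I = \bigcup_(J in C I) J],
          T = \bigcup_m tree_level C m &
          differentiates_L1 mu (tree_level C)]].

Definition maximal_op d (X : measurableType d) (R : realType)
    (mu : probability X R) (T : set (set X)) (psi : X -> R) (x : X) : \bar R :=
  ereal_sup [set ((mu I)^-1 * \int[mu]_(y in I) `|psi y|%:E)%E
            | I in [set I | T I /\ I x]].

(* Takes extended-real functions because maximal_op may be +oo on a null set;
   mu E is finite and positive, so the factor (fine (mu E)) `^ _ is the
   genuine power. *)
Definition weak_norm d (X : measurableType d) (R : realType)
    (mu : probability X R) (p q : R) (g : X -> \bar R) : \bar R :=
  ereal_sup [set ((fine (mu E) `^ (- p^-1 + q^-1))%:E *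
                  (\int[mu]_(x in E) (`|g x| `^ p)) `^ p^-1)%E
            | E in [set E | measurable E /\ (0 < mu E)%E]].

Definition cNp (R : realType) (N : nat) (p : R) : R :=
  (p - 1) / p * ((N%:R `^ p - 1) / (N%:R `^ p - N%:R)).

(* Main.v *)
Require Import Defs.
From mathcomp Require Import all_boot all_order all_algebra.
From mathcomp Require Import all_classical all_reals all_analysis.
From mathcomp Require Import finmap measurable_realfun ring lra.
Set Implicit Arguments.
Unset Strict Implicit.
Unset Printing Implicit Defensive.
Import Order.TTheory GRing.Theory Num.Theory.
Import numFieldNormedType.Exports.
Local Open Scope classical_set_scope.
Local Open Scope ring_scope.

(** Write k = (N^p - 1) / (N^p - N), so that c(N,p) = (p - 1) / p * k, and M for
    the maximal function of phi. Everything follows from one inequality, valid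
    for every level lam >= f (lemma [maximal_energy]):

      int max(lam, M)^p + k lam^(p-1) f >= k F + lam^p.

    To prove it, let L_m be the larger of lam and the averages of phi over the
    first m generations of cells containing the point; L_m is constant on the
    cells of generation m, hence int L_m^(p-1) phi only sees the averages of
    phi over these cells. When L_m jumps from a to y, the new value y is the
    average over the current cell, and y <= N a because a cell has 1/N
    of the measure of its parent. On the range a <= y <= N a the convexity of
    t^p gives ([jump_cost])

      y^p - a^p >= k (y^(p-1) - a^(p-1)) y,

    so the quantity int L_m^p - k int L_m^(p-1) phi does not decrease with m
    ([runmax_energy]). As m grows, int L_m^(p-1) phi increases to a limit which is
    at least int phi^p, since L_m dominates averages that converge to phi almost
    everywhere.

    For lam = f one has max(f, M) = M, and testing the weak norm on the whole
    space gives the second term of both maxima. In case (ii) this term is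
    already the larger one ([mean_bound_dominates]): after a weighted
    arithmetic-geometric inequality the comparison becomes linear in f^p.

    In case (i) the weak norm A is tested on the set where M > lam, of measure
    D. It gives int M^p <= A^p D^(1-p/q) there, and a weighted
    arithmetic-geometric inequality makes the bound affine in D with a slope
    that does not exceed lam^p, so that D disappears ([level_set_bound]):

      k (F - lam^(p-1) f) <= (p/q) lam^(p-q) A^q.

    The best level is lam^(p-1) = (q - p) F / ((q - 1) f); the hypothesis of
    case (i) says exactly that this level exceeds f, and it produces the first
    term of the maximum ([critical_level_bound]). *)

(** * Convexity inequalities for real powers *)

(** Young's inequality for a^t and b^(1-t) with the exponents 1/t and 1/(1-t). *)
Lemma weighted_AMGM (R : realType) (a b t : R) :
  0 <= a -> 0 <= b -> 0 < t < 1 ->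
  a `^ t * b `^ (1 - t) <= t * a + (1 - t) * b.
Proof.
move=> a0 b0 /andP[t0 t1].
have t1' : 0 < 1 - t by rewrite subr_gt0.
rewrite [t * a]mulrC [(1 - t) * b]mulrC.
have Ea : (a `^ t) `^ t^-1 = a by rewrite -powRrM divff ?gt_eqF// powRr1.
have Eb : (b `^ (1 - t)) `^ (1 - t)^-1 = b.
  by rewrite -powRrM divff ?gt_eqF// powRr1.
rewrite -[in leRHS]Ea -[in leRHS]Eb.
have := @conjugate_powR R (a `^ t) (b `^ (1 - t)) t^-1 (1 - t)^-1.
rewrite !invrK; apply=> //; rewrite ?powR_ge0 ?invr_gt0//.
by rewrite subrKC.
Qed.

(** The weighted arithmetic-geometric inequality for x^p and 1 with weight 1/p. *)
Lemma bernoulli_powR (R : realType) (p x : R) :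
  1 < p -> 0 <= x -> p * x <= x `^ p + (p - 1).
Proof.
move=> p1 x0; have p0 : 0 < p by lra.
have := @weighted_AMGM R (x `^ p) 1 p^-1 (powR_ge0 _ _) ler01.
rewrite invr_gt0 p0 invf_lt1// p1 => /(_ erefl).
rewrite -powRrM divff ?gt_eqF// powRr1// powR1 !mulr1 => H.
have -> : x `^ p + (p - 1) = p * (p^-1 * x `^ p + (1 - p^-1)) by field; lra.
by rewrite ler_pM2l.
Qed.

(** The number for which t |-> kappa t - 1 and t |-> (kappa - 1) t^p agree at both
    t = 1 and t = N. *)
Definition kappa {R : realType} (N : nat) (p : R) : R :=
  (N%:R `^ p - 1) / (N%:R `^ p - N%:R).

Lemma ltr_powR_gt1 (R : realType) (N : nat) (p : R) :
  (1 < N)%N -> 1 < p -> N%:R < N%:R `^ p.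
Proof.
move=> N1 p1; have N1' : 1 < N%:R :> R by rewrite ltr1n.
rewrite -[X in X < _](@powRr1 R) ?ler0n// /powR gt_eqF ?(lt_trans ltr01)//.
by rewrite ltr_expR ltr_pM2r// ln_gt0.
Qed.

Lemma kappa_gt1 (R : realType) (N : nat) (p : R) :
  (1 < N)%N -> 1 < p -> 1 < kappa N p.
Proof.
move=> N1 p1; have N1' : 1 < N%:R :> R by rewrite ltr1n.
have := @ltr_powR_gt1 R N p N1 p1 => NN.
by rewrite /kappa ltr_pdivlMr ?subr_gt0// mul1r; lra.
Qed.

Lemma cNp_kappa (R : realType) (N : nat) (p : R) :
  cNp N p = (p - 1) / p * kappa N p.
Proof. by []. Qed.

(** After clearing denominators this is Bernoulli's inequality for N^p. *)
Lemma cNp_le1 (R : realType) (N : nat) (p : R) :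
  (1 < N)%N -> 1 < p -> cNp N p <= 1.
Proof.
move=> N1 p1; have NN := @ltr_powR_gt1 R N p N1 p1.
have B := @bernoulli_powR R p N%:R p1 (ler0n _ _).
have -> : cNp N p =
  ((N%:R `^ p - 1) * (p - 1)) / ((N%:R `^ p - N%:R) * p) :> R.
  by rewrite /cNp; field; apply/andP; split; lra.
rewrite ler_pdivrMr; last by rewrite mulr_gt0//; lra.
by rewrite mul1r; lra.
Qed.

(** The right side is the chord over [1, N] of the convex function on the left. *)
Lemma kappa_chord (R : realType) (N : nat) (p t : R) :
  (1 < N)%N -> 1 < p -> 1 <= t <= N%:R ->
  (kappa N p - 1) * t `^ p <= kappa N p * t - 1.
Proof.
move=> N1 p1 /andP[t1 tN].
have N1' : 1 < N%:R :> R by rewrite ltr1n.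
have NN := @ltr_powR_gt1 R N p N1 p1.
pose s : R := (N%:R - t) / (N%:R - 1).
have s01 : 0 <= s <= 1.
  by rewrite divr_ge0 ?ler_pdivrMr//= ?mul1r; lra.
have [s0 s1] := andP s01.
have /= := @convex_powR R p (ltW p1) (Itv01 s0 s1) 1 N%:R.
rewrite !mem_setE !in_itv/= ler01 ler0n => /(_ erefl erefl).
rewrite convRE [X in X `^ _ <= _]convRE/= powR1 /unstable.onem.
have -> : s * 1 + (1 - s) * N%:R = t by rewrite /s; field; lra.
move=> H.
have K1 := @kappa_gt1 R N p N1 p1.
apply: (@le_trans _ _ ((kappa N p - 1) * (s * 1 + (1 - s) * N%:R `^ p))).
  by rewrite ler_pM2l ?subr_gt0.
rewrite le_eqVlt; apply/orP; left; apply/eqP; rewrite /kappa /s.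
by field; apply/andP; split; lra.
Qed.

(** The chord inequality at t = y / a, multiplied by a^p. Here a is the running
    maximum, y the average that replaces it, and the bound y <= N a expresses
    that no cell is smaller than 1/N of its parent. *)
Lemma jump_cost (R : realType) (N : nat) (p a y : R) :
  (1 < N)%N -> 1 < p -> 0 < a -> a <= y <= N%:R * a ->
  a `^ p + kappa N p * y `^ (p - 1) * y <=
  y `^ p + kappa N p * a `^ (p - 1) * y.
Proof.
move=> N1 p1 a0 /andP[ay yN]; have y0 : 0 < y by lra.
have p0 : 0 < p by lra.
have a0p := ltW a0; have y0p := ltW y0.
rewrite -2!mulrA [y `^ (p - 1) * y]mulrC mulr_powRB1//.
have := @kappa_chord R N p (y / a) N1 p1.
rewrite ler_pdivlMr// ler_pdivrMr// mul1r ay yN => /(_ erefl).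
have ap : 0 < a `^ p by rewrite powR_gt0.
rewrite -(ler_pM2r ap) -mulrA -powRM ?divr_ge0//.
rewrite divfK ?gt_eqF// => H.
have -> : a `^ (p - 1) * y = a `^ p * (y / a).
  by rewrite -(@mulr_powRB1 _ a p)//; field; lra.
by lra.
Qed.

(** Replacing c^(p/q) by its upper bound (p c + q - p) / q makes the difference of
    the two sides proportional to (1 - c) ((q - 1) u - (q - p) F). *)
Lemma powR_mean_bound (R : realType) (p q c u F : R) :
  1 < p -> p < q -> 0 < c -> c <= 1 -> 0 <= u -> u <= F ->
  (q - p) * F <= (q - 1) * u ->
  c `^ (p / q) * (p * F - u) <= c * p * (F - u) + (p - 1) * u.
Proof.
move=> p1 pq c0 c1 u0 uF H.
have := @weighted_AMGM R c 1 (p / q) (ltW c0) ler01.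
rewrite divr_gt0 ?ltr_pdivrMr ?mul1r ?pq; [|lra..] => /(_ erefl).
rewrite powR1 !mulr1 => E.
have pFu : 0 <= p * F - u by nra.
apply: (le_trans (ler_wpM2r pFu E)).
have q0 : 0 < q by lra.
rewrite -(ler_pM2l q0).
have -> : q * ((p / q * c + (1 - p / q)) * (p * F - u)) =
  (p * c + (q - p)) * (p * F - u) by field; lra.
rewrite -subr_ge0.
have -> : q * (c * p * (F - u) + (p - 1) * u) - (p * c + (q - p)) * (p * F - u)
 = (1 - c) * (p * ((q - 1) * u - (q - p) * F)) by ring.
by rewrite mulr_ge0 ?mulr_ge0; lra.
Qed.

(** * The levels of a homogeneous tree *)

Section tree_geometry.
Context (R : realType) (d : measure_display) (X : measurableType d)
  (mu : probability X R) (N : nat) (T : set (set X)) (C : set X -> set (set X)).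
Hypothesis N1 : (1 < N)%N.
Hypothesis mT : forall I, T I -> measurable I.
Hypothesis C_card : forall I, T I -> (C I #= `I_N)%card.
Hypothesis C_mu : forall I J, T I -> C I J -> mu J = ((N%:R^-1)%:E * mu I)%E.
Hypothesis C_triv : forall I, T I -> trivIset (C I) id.
Hypothesis C_cover : forall I, T I -> I = \bigcup_(J in C I) J.
Hypothesis TE : T = \bigcup_m tree_level C m.

Local Notation lev := (tree_level C).

Lemma level_tree m I : lev m I -> T I.
Proof. by move=> mI; rewrite TE; exists m. Qed.

Lemma child_sub I J : T I -> C I J -> J `<=` I.
Proof. by move=> TI IJ x Jx; rewrite (C_cover TI); exists J. Qed.

Lemma finite_level m : finite_set (lev m).
Proof.
elim: m => [|m IH] /=; first exact: finite_set1.
apply: bigcup_finite => // I /level_tree TI.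
by exists N; exact: C_card.
Qed.

Lemma level_measurable m I : lev m I -> measurable I.
Proof. by move=> /level_tree /mT. Qed.

Lemma level_cover m x : exists I, lev m I /\ I x.
Proof.
elim: m => [|m [I [mI Ix]]] /=; first by exists setT.
have TI := level_tree mI; move: Ix; rewrite {1}(C_cover TI) => -[J IJ Jx].
by exists J; split=> //; exists I.
Qed.

Lemma level_uniq m I J x : lev m I -> lev m J -> I x -> J x -> I = J.
Proof.
elim: m I J => [|m IH] I J /=; first by move=> -> ->.
move=> [I' mI' I'I] [J' mJ' J'J] Ix Jx.
have TI' := level_tree mI'; have TJ' := level_tree mJ'.
have I'J' : I' = J'.
  by apply: (IH _ _ mI' mJ'); [exact: (child_sub TI' I'I)|exact: (child_sub TJ' J'J)].
by apply: (C_triv TI') => //; [rewrite I'J'|exists x].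
Qed.

Lemma level_mu m I : lev m I -> mu I = ((N%:R ^- m : R)%:E)%E.
Proof.
elim: m I => [|m IH] I /=; first by move=> ->; rewrite probability_setT expr0 invr1.
move=> [J mJ JI]; rewrite (C_mu (level_tree mJ) JI) (IH _ mJ) -EFinM.
by rewrite exprS invfM.
Qed.

(** The default value of [xget] is never taken, since every level covers [X]. *)
Definition cell m x : set X := xget setT [set I | lev m I /\ I x].

Lemma cellP m x : lev m (cell m x) /\ cell m x x.
Proof. exact: (@xgetPex _ setT [set I | lev m I /\ I x] (level_cover m x)). Qed.

Lemma cell_level m I x : lev m I -> I x -> cell m x = I.
Proof.
by have [mc cx] := cellP m x => mI Ix; exact: (@level_uniq m _ _ x).
Qed.

Lemma cell_child m x : C (cell m x) (cell m.+1 x).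
Proof.
have [/= [I mI IJ] cx] := cellP m.+1 x.
by rewrite (cell_level mI (child_sub (level_tree mI) IJ cx)).
Qed.

Lemma cell_mu m x : mu (cell m x) = ((N%:R ^- m : R)%:E)%E.
Proof. by have [/level_mu] := cellP m x. Qed.

Lemma cell_sub m x : cell m.+1 x `<=` cell m x.
Proof.
by apply: child_sub (cell_child m x); have [/level_tree] := cellP m x.
Qed.

(** The cells of one level form a finite measurable partition, so an inequality
    between integrals may be checked cell by cell. *)
Lemma ge0_le_integral_level m (g h : X -> \bar R) :
  measurable_fun [set: X] g -> measurable_fun [set: X] h ->
  (forall x, 0 <= g x)%E -> (forall x, 0 <= h x)%E ->
  (forall J, lev m J -> \int[mu]_(x in J) g x <= \int[mu]_(x in J) h x)%E ->
  (\int[mu]_x g x <= \int[mu]_x h x)%E.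
Proof.
move=> mg mh g0 h0 gh.
have cover : [set: X] = \big[setU/set0]_(J <- fset_set (lev m)) J.
  rewrite (bigsetU_fset_set _ (finite_level m)); apply/seteqP; split=> x // _.
  by have [mc cx] := cellP m x; exists (cell m x).
have mlev J : J \in fset_set (lev m) -> lev m J.
  by rewrite (in_fset_set (finite_level m)) => /set_mem.
have triv : trivIset [set` fset_set (lev m)] id.
  by move=> I J /= /mlev mI /mlev mJ [x [Ix Jx]]; exact: (level_uniq mI mJ Ix Jx).
pose F (J : set X) := if J \in fset_set (lev m) then J else set0.
have coverF : [set: X] = \big[setU/set0]_(J <- fset_set (lev m)) F J.
  by rewrite cover; apply: eq_big_seq => J Jm; rewrite /F Jm.
have trivF : trivIset [set` fset_set (lev m)] F.
  by move=> I J /= Im Jm; rewrite /F Im Jm; exact: triv.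
have mF J : measurable (F J).
  by rewrite /F; case: ifPn => // /mlev /level_measurable.
rewrite coverF !ge0_integral_bigsetU//= -?coverF//.
rewrite big_seq [leRHS]big_seq; apply: lee_sum => J Jm.
by rewrite /F Jm; exact/gh/mlev.
Qed.

Lemma measurable_level_fun m (g : X -> R) :
  (forall x y, cell m x = cell m y -> g x = g y) -> measurable_fun [set: X] g.
Proof.
move=> gc _ Y mY; rewrite setTI.
have -> : g @^-1` Y = \bigcup_(I in [set I | lev m I /\ I `<=` g @^-1` Y]) I.
  apply/seteqP; split=> [x Yx|x [I [_ IY] /IY]//].
  have [mc cx] := cellP m x; exists (cell m x) => //; split=> // y cy /=.
  by rewrite (gc y x) //; exact: (cell_level mc cy).
apply: fin_bigcup_measurable => [|I [/level_measurable]//].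
by apply: sub_finite_set (finite_level m) => I [].
Qed.

(** * The running maximum of the averages *)

Context (phi : X -> R) (p f lam : R).
Hypothesis mphi : measurable_fun [set: X] phi.
Hypothesis phi0 : forall x, 0 <= phi x.
Hypothesis phi_f : (\int[mu]_x (phi x)%:E = f%:E)%E.
Hypothesis p1 : 1 < p.
Hypothesis f0 : 0 < f.
Hypothesis flam : f <= lam.

(** All that matters about the constant [kappa N p] is its sign and the jump
    inequality. *)
Context (kap : R).
Hypothesis kap_gt0 : 0 < kap.
Hypothesis kap_jump : forall a y : R, 0 < a -> a <= y <= N%:R * a ->
  a `^ p + kap * y `^ (p - 1) * y <= y `^ p + kap * a `^ (p - 1) * y.

Lemma phi_int_fin J : measurable J -> (\int[mu]_(x in J) (phi x)%:E)%E \is a fin_num.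
Proof.
move=> mJ; rewrite ge0_fin_numE; last by apply: integral_ge0 => x _; rewrite lee_fin.
apply: (@le_lt_trans _ _ f%:E); last exact: ltry.
rewrite -phi_f; apply: ge0_subset_integral => //.
- exact/measurable_EFinP.
- by move=> x _; rewrite lee_fin.
Qed.

Definition avg m x : R := (fine (mu (cell m x)))^-1 * Rintegral mu (cell m x) phi.

Lemma cell_measurable m x : measurable (cell m x).
Proof. by have [/level_measurable] := cellP m x. Qed.

Lemma Npow_gt0 m : 0 < N%:R ^+ m :> R.
Proof. by rewrite exprn_gt0// ltr0n (ltn_trans _ N1). Qed.

Lemma avg_int m x :
  (\int[mu]_(y in cell m x) (phi y)%:E = (N%:R ^- m * avg m x)%:E)%E.
Proof.
rewrite /avg cell_mu /= mulrA divff ?mul1r ?fineK//.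
- exact/phi_int_fin/cell_measurable.
- by rewrite invr_eq0 gt_eqF// Npow_gt0.
Qed.

Lemma avg_ge0 m x : 0 <= avg m x.
Proof.
rewrite /avg cell_mu; apply: mulr_ge0; first by rewrite !invr_ge0 exprn_ge0.
by apply: fine_ge0; apply: integral_ge0 => y _; rewrite lee_fin.
Qed.

Lemma cell0 x : cell 0 x = [set: X].
Proof. by have [] := cellP 0 x. Qed.

Lemma avg0 x : avg 0 x = f.
Proof.
have := avg_int 0 x; rewrite cell0 phi_f expr0 invr1 mul1r.
by move=> [].
Qed.

(** The integral over a child is at most the integral over its parent, whose
    measure is N times larger. *)
Lemma avg_step m x : avg m.+1 x <= N%:R * avg m x.
Proof.
have : (\int[mu]_(y in cell m.+1 x) (phi y)%:E <=
        \int[mu]_(y in cell m x) (phi y)%:E)%E.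
  apply: ge0_subset_integral => //.
  - exact: cell_measurable.
  - exact: cell_measurable.
  - by apply/measurable_EFinP; exact: measurable_funTS.
  - by move=> y _; rewrite lee_fin.
  - exact: cell_sub.
have N0 k : N%:R ^+ k != 0 :> R by rewrite gt_eqF// Npow_gt0.
rewrite !avg_int lee_fin -(ler_pM2l (Npow_gt0 m.+1)) mulVKf//.
by rewrite exprS -mulrA mulVKf.
Qed.

Lemma avg_cell m x y : cell m x = cell m y -> avg m x = avg m y.
Proof. by rewrite /avg => ->. Qed.

Lemma cell_coarse m x y : cell m.+1 x = cell m.+1 y -> cell m x = cell m y.
Proof.
move=> xy; apply/esym; have [mc _] := cellP m x; apply: cell_level mc _.
by apply: cell_sub; rewrite xy; have [] := cellP m.+1 y.
Qed.

(** Generation 0 is not compared with [lam]: its average is [f], which is at most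
    [lam]. *)
Fixpoint runmax m x : R :=
  if m is k.+1 then Num.max (runmax k x) (avg k.+1 x) else lam.

Lemma runmax_ge m x : lam <= runmax m x.
Proof. by elim: m => [|m IH]//=; rewrite le_max IH. Qed.

Lemma runmax_gt0 m x : 0 < runmax m x.
Proof. by apply: lt_le_trans (runmax_ge m x); exact: lt_le_trans f0 flam. Qed.

Lemma avg_runmax m x : avg m x <= runmax m x.
Proof. by case: m => [|m]/=; rewrite ?avg0// le_max lexx orbT. Qed.

Lemma runmax_step m x : runmax m x <= runmax m.+1 x.
Proof. by rewrite /= le_max lexx. Qed.

Lemma runmax_cell m x y : cell m x = cell m y -> runmax m x = runmax m y.
Proof.
elim: m => [//|m IH] xy /=.
by rewrite (avg_cell xy) IH//; exact: cell_coarse.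
Qed.

(** A new maximum is an average over a cell whose parent has an average that was
    already taken into account. *)
Lemma runmax_jump m x : runmax m.+1 x <= N%:R * runmax m x.
Proof.
rewrite /= ge_max; apply/andP; split.
  by rewrite ler_peMl ?ler1n ?(ltnW N1)// ltW// runmax_gt0.
by apply: le_trans (avg_step _ _) _; rewrite ler_wpM2l// avg_runmax.
Qed.

(** Makes the integrals below finite, so that they can be cancelled. *)
Lemma runmax_bound m x : runmax m x <= N%:R ^+ m * lam.
Proof.
elim: m => [|m IH]; first by rewrite expr0 mul1r.
apply: le_trans (runmax_jump _ _) _.
by rewrite exprS -mulrA ler_wpM2l.
Qed.

Lemma measurable_runmax_powR m r : measurable_fun [set: X] (fun x => runmax m x `^ r).
Proof.
by apply: (@measurable_level_fun m) => x y /runmax_cell ->.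
Qed.

(** On a cell where the running maxima are constant, the integrand of the energy
    is affine in [phi], so its integral only depends on the average of [phi]. *)
Lemma cell_affine_int m x (u v : R) : 0 <= u -> 0 <= v ->
  (\int[mu]_(y in cell m x) (u + v * phi y)%:E =
   (N%:R ^- m * (u + v * avg m x))%:E)%E.
Proof.
move=> u0 v0; under eq_integral do rewrite EFinD EFinM.
have mc := cell_measurable m x.
have mphi' : measurable_fun (cell m x) (EFin \o phi).
  by apply/measurable_EFinP; exact: measurable_funTS.
rewrite ge0_integralD//; last 2 first.
- by move=> y _; rewrite -EFinM lee_fin mulr_ge0.
- exact: measurable_funeM.
rewrite integral_cst// ge0_integralZl_EFin//; last by move=> y _; rewrite lee_fin.
rewrite avg_int [X in (_ * X)%E]cell_mu -!EFinM -EFinD; congr EFin; ring.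
Qed.

(** Either the running maximum does not change on [J], and there is equality, or
    it jumps to the average over [J], and the jump inequality applies. *)
Lemma runmax_level_le m J : lev m.+1 J ->
  (\int[mu]_(x in J) (runmax m x `^ p + kap * runmax m.+1 x `^ (p - 1) * phi x)%:E <=
   \int[mu]_(x in J) (runmax m.+1 x `^ p + kap * runmax m x `^ (p - 1) * phi x)%:E)%E.
Proof.
move=> mJ.
have [x Jx] : exists x, J x.
  apply/set0P/eqP => J0; have := level_mu mJ; rewrite J0 measure0 => -[] /esym/eqP.
  by rewrite invr_eq0 gt_eqF// Npow_gt0.
have Jc : J = cell m.+1 x by rewrite (cell_level mJ Jx).
have K0 := ltW kap_gt0.
have kpow z r : 0 <= kap * z `^ r by rewrite mulr_ge0// powR_ge0.
have cst y : y \in J -> runmax m.+1 y = runmax m.+1 x /\ runmax m y = runmax m x.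
  move=> /set_mem Jy; have yx : cell m.+1 y = cell m.+1 x by rewrite (cell_level mJ Jy).
  by split; apply: runmax_cell => //; exact: cell_coarse.
rewrite (eq_integral (fun y => (runmax m x `^ p +
  kap * runmax m.+1 x `^ (p - 1) * phi y)%:E)); last by move=> y /cst[-> ->].
rewrite [leRHS](eq_integral (fun y => (runmax m.+1 x `^ p +
  kap * runmax m x `^ (p - 1) * phi y)%:E)); last by move=> y /cst[-> ->].
rewrite Jc !cell_affine_int ?powR_ge0 ?kpow//.
rewrite lee_fin ler_pM2l ?invr_gt0 ?Npow_gt0//.
have [le|gt] := leP (avg m.+1 x) (runmax m x).
  by rewrite /= max_l.
rewrite /= max_r; last exact: ltW.
apply: kap_jump => //; first exact: runmax_gt0.
rewrite ltW//=; apply: le_trans (avg_step _ _) _.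
by rewrite ler_wpM2l// avg_runmax.
Qed.

Lemma integrand_measurable m r :
  measurable_fun [set: X] (fun x => (runmax m x `^ r * phi x)%:E).
Proof.
by apply/measurable_EFinP; apply: measurable_funM => //; exact: measurable_runmax_powR.
Qed.

Lemma powR_integrand_measurable m r :
  measurable_fun [set: X] (fun x => (runmax m x `^ r)%:E).
Proof. by apply/measurable_EFinP; exact: measurable_runmax_powR. Qed.

Lemma runmax_powR_le m r x : 0 <= r -> runmax m x `^ r <= (N%:R ^+ m * lam) `^ r.
Proof.
move=> r0; have L0 := ltW (runmax_gt0 m x); have LB := runmax_bound m x.
by apply: ge0_ler_powR; rewrite ?nnegrE// (le_trans L0).
Qed.

Lemma runmax_powR_int_fin m : (\int[mu]_x (runmax m x `^ p)%:E)%E \is a fin_num.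
Proof.
have p0 : 0 <= p by rewrite ltW// (lt_trans ltr01).
rewrite ge0_fin_numE; last by apply: integral_ge0 => x _; rewrite lee_fin powR_ge0.
apply: (@le_lt_trans _ _ (\int[mu]_(x in setT) (cst ((N%:R ^+ m * lam) `^ p)%:E x))%E).
  apply: ge0_le_integral => //.
  - by move=> x _; rewrite lee_fin powR_ge0.
  - exact: powR_integrand_measurable.
  - by move=> x _; rewrite lee_fin runmax_powR_le.
by rewrite integral_cst// [X in (_ * X)%E]probability_setT mule1 ltry.
Qed.

Lemma runmax_phi_int_fin m :
  (\int[mu]_x (runmax m x `^ (p - 1) * phi x)%:E)%E \is a fin_num.
Proof.
have p0 : 0 <= p - 1 by rewrite subr_ge0 ltW.
rewrite ge0_fin_numE; last first.
  by apply: integral_ge0 => x _; rewrite lee_fin mulr_ge0// powR_ge0.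
apply: (@le_lt_trans _ _ (\int[mu]_x (((N%:R ^+ m * lam) `^ (p - 1))%:E * (phi x)%:E))%E).
  apply: ge0_le_integral => //.
  - by move=> x _; rewrite lee_fin mulr_ge0// powR_ge0.
  - exact: integrand_measurable.
  - by apply: measurable_funeM; exact/measurable_EFinP.
  - by move=> x _; rewrite -EFinM lee_fin ler_wpM2r// runmax_powR_le.
rewrite ge0_integralZl_EFin//.
- by rewrite phi_f -EFinM ltry.
- by move=> x _; rewrite lee_fin.
- exact/measurable_EFinP.
- exact: powR_ge0.
Qed.

Lemma runmax_int_split m k :
  (\int[mu]_x (runmax m x `^ p + kap * runmax k x `^ (p - 1) * phi x)%:E =
   \int[mu]_x (runmax m x `^ p)%:E +
   kap%:E * \int[mu]_x (runmax k x `^ (p - 1) * phi x)%:E)%E.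
Proof.
under eq_integral do rewrite EFinD -mulrA EFinM.
have k0 := ltW kap_gt0.
rewrite ge0_integralD//.
- rewrite ge0_integralZl_EFin//.
  + by move=> x _; rewrite lee_fin mulr_ge0// powR_ge0.
  + exact: integrand_measurable.
- by move=> x _; rewrite lee_fin powR_ge0.
- exact: powR_integrand_measurable.
- move=> x _; rewrite -EFinM lee_fin; apply: mulr_ge0 => //.
  by rewrite mulr_ge0// powR_ge0.
- by apply: measurable_funeM; exact: integrand_measurable.
Qed.

(** The inequality int L^p - kap int L^(p-1) phi >= lam^p - kap lam^(p-1) f, with
    the negative terms moved across so that both sides are sums of nonnegative
    extended reals. [runmax_level_le], summed over a level, is the induction step. *)
Lemma runmax_energy m :
  (kap%:E * \int[mu]_x (runmax m x `^ (p - 1) * phi x)%:E + (lam `^ p)%:E <=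
   \int[mu]_x (runmax m x `^ p)%:E + (kap * (lam `^ (p - 1) * f))%:E)%E.
Proof.
elim: m => [|m IH].
  rewrite (eq_integral (fun x => (lam `^ (p - 1))%:E * (phi x)%:E)%E); last first.
    by move=> x _; rewrite -EFinM.
  rewrite ge0_integralZl_EFin ?powR_ge0//; last 2 first.
  - by move=> x _; rewrite lee_fin.
  - exact/measurable_EFinP.
  rewrite phi_f (eq_integral (cst (lam `^ p)%:E))//.
  rewrite integral_cst// [X in (_ <= _ * X + _)%E]probability_setT mule1.
  by rewrite -!EFinM -!EFinD lee_fin addrC.
have : (\int[mu]_x (runmax m x `^ p + kap * runmax m.+1 x `^ (p - 1) * phi x)%:E <=
   \int[mu]_x (runmax m.+1 x `^ p + kap * runmax m x `^ (p - 1) * phi x)%:E)%E.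
  have M a b : measurable_fun [set: X]
      (fun x => (runmax a x `^ p + kap * runmax b x `^ (p - 1) * phi x)%:E).
    apply/measurable_EFinP; apply: measurable_funD; first exact: measurable_runmax_powR.
    apply: measurable_funM => //; apply: measurable_funM => //.
    exact: measurable_runmax_powR.
  have G a b x : (0 <= (runmax a x `^ p + kap * runmax b x `^ (p - 1) * phi x)%:E)%E.
    rewrite lee_fin addr_ge0 ?powR_ge0//.
    exact: mulr_ge0 (mulr_ge0 (ltW kap_gt0) (powR_ge0 _ _)) (phi0 x).
  apply: (@ge0_le_integral_level m.+1).
  - exact: M.
  - exact: M.
  - exact: G.
  - exact: G.
  - exact: runmax_level_le.
rewrite !runmax_int_split; move: IH.
(* All four integrals are finite: continue with real numbers. *)
rewrite -(fineK (runmax_powR_int_fin m)) -(fineK (runmax_powR_int_fin m.+1)).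
rewrite -(fineK (runmax_phi_int_fin m)) -(fineK (runmax_phi_int_fin m.+1)).
move: (fine _) (fine _) (fine _) (fine _) => a b a' b'.
by rewrite -!EFinM -!EFinD !lee_fin; lra.
Qed.

(** * Passage to the maximal function *)

Context (F : R).
Hypothesis phi_F : (\int[mu]_x (phi x `^ p)%:E = F%:E)%E.
Hypothesis lev_diff : differentiates_L1 mu lev.

Local Notation M := (maximal_op mu T phi).

(** The supremum over the tree is taken along the sequence of cells that contain
    the point; written with [esups], its measurability is a known fact. *)
Lemma maximal_sup x : M x = esups (fun m => (avg m x)%:E) 0.
Proof.
have term I m : lev m I -> I x ->
    ((mu I)^-1 * \int[mu]_(y in I) `|phi y|%:E)%E = (avg m x)%:E.
  move=> mI Ix; rewrite -(cell_level mI Ix) cell_mu inver ifF; last first.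
    by rewrite invr_eq0 gt_eqF// Npow_gt0.
  under eq_integral do rewrite ger0_norm//.
  rewrite avg_int -EFinM mulrA mulVf ?mul1r//.
  by rewrite invr_eq0 gt_eqF// Npow_gt0.
rewrite /maximal_op /esups/=; congr ereal_sup.
apply/seteqP; split => [_ [I [TI Ix] <-]|_ [m _ <-]].
  have [m _ mI] : (\bigcup_m lev m) I by rewrite -TE.
  by exists m => //; rewrite -(term _ _ mI Ix).
have [mI Ix] := cellP m x; exists (cell m x); last exact: term.
by split=> //; exact: level_tree mI.
Qed.

Lemma measurable_avg m : measurable_fun [set: X] (avg m).
Proof. by apply: (@measurable_level_fun m) => x y; exact: avg_cell. Qed.

Lemma measurable_maximal : measurable_fun [set: X] M.
Proof.
rewrite (_ : M = fun x => esups (fun m => (avg m x)%:E) 0); last first.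
  by apply/funext => x; exact: maximal_sup.
apply: (@measurable_fun_esups _ _ _ _ (fun m x => (avg m x)%:E)) => m.
by apply/measurable_EFinP; exact: measurable_avg.
Qed.

Lemma avg_maximal m x : ((avg m x)%:E <= M x)%E.
Proof. by rewrite maximal_sup; apply: ereal_sup_ubound; exists m. Qed.

Lemma runmax_maximal m x : ((runmax m x)%:E <= maxe lam%:E (M x))%E.
Proof.
elim: m => [|m IH] /=; first by rewrite le_max lexx.
by rewrite EFin_max ge_max IH/= le_max avg_maximal orbT.
Qed.

Lemma runmax_homo x : {homo (fun m => runmax m x) : m n / (m <= n)%N >-> m <= n}.
Proof. by apply: homo_leq => //; [exact: le_trans|move=> m; exact: runmax_step]. Qed.

Lemma integrand_homo r x : 0 <= r ->
  {homo (fun m => (runmax m x `^ r * phi x)%:E) : m n / (m <= n)%N >-> (m <= n)%E}.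
Proof.
move=> r0 m n mn; rewrite lee_fin ler_wpM2r// ge0_ler_powR ?nnegrE//.
- exact/ltW/runmax_gt0.
- exact/ltW/runmax_gt0.
- exact: runmax_homo.
Qed.

Lemma powR_continuous_at (r a : R) : 0 < a -> {for a, continuous (@powR R ^~ r)}.
Proof.
move=> a0; apply: differentiable_continuous; apply/derivable1_diffP.
by apply: derivable_powR; rewrite in_itv/= a0.
Qed.

(** Almost everywhere the averages converge to [phi x], and the running maximum is
    at least the average. *)
Lemma integrand_limit_ge :
  {ae mu, forall x, [set: X] x ->
    ((phi x `^ p)%:E <= limn (fun m => (runmax m x `^ (p - 1) * phi x)%:E))%E}.
Proof.
have p10 : 0 <= p - 1 by rewrite subr_ge0 ltW.
have p0 : 0 < p by rewrite (lt_trans ltr01).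
have phi_integrable : mu.-integrable [set: X] (EFin \o phi).
  apply/integrableP; split; first exact/measurable_EFinP.
  under eq_integral do rewrite /= ger0_norm//.
  by rewrite phi_f ltry.
apply: filterS (lev_diff phi_integrable) => x /(_ (cell ^~ x)).
move=> /(_ (fun m => cellP m x)) cv _.
have lim_ge m : ((avg m x `^ (p - 1) * phi x)%:E <=
    limn (fun m => (runmax m x `^ (p - 1) * phi x)%:E))%E.
  rewrite (cvg_lim _ (ereal_nondecreasing_cvgn (integrand_homo x p10)))//.
  apply: (@le_trans _ _ (runmax m x `^ (p - 1) * phi x)%:E).
    rewrite lee_fin ler_wpM2r// ge0_ler_powR ?nnegrE ?avg_ge0//.
    - exact/ltW/runmax_gt0.
    - exact: avg_runmax.
  by apply: ereal_sup_ubound; exists m.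
(* [powR] equals 1 on negative numbers, so its continuity fails at 0. *)
have [phix0|phix_gt0] := leP (phi x) 0.
  have phixE : phi x = 0 by apply/eqP; rewrite eq_le phix0 phi0.
  apply: le_trans (lim_ge 0%N); rewrite lee_fin phixE mulr0 powR0//.
  by rewrite gt_eqF.
rewrite -(mulr_powRB1 (phi0 x) p0) mulrC.
have cvE : ((avg m x `^ (p - 1) * phi x)%:E @[m --> \oo] -->
    (phi x `^ (p - 1) * phi x)%:E)%E.
  apply: cvg_EFin; first exact: nearW.
  apply: cvgM; last exact: cvg_cst.
  exact: (@continuous_cvg _ _ _ _ _ _ (@powR R ^~ (p - 1)) _
            (powR_continuous_at phix_gt0) cv).
rewrite -(cvg_lim _ cvE)//; apply: lime_le.
  by apply/cvg_ex; exists (phi x `^ (p - 1) * phi x)%:E.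
exact: nearW.
Qed.

(** The energy inequality in the limit: the left side passes to the limit by
    monotone convergence, the right side is bounded because the running maxima
    stay below max(lam, M). *)
Lemma maximal_energy :
  ((kap * F + lam `^ p)%:E <=
   \int[mu]_x (maxe lam%:E (M x) `^ p) + (kap * (lam `^ (p - 1) * f))%:E)%E.
Proof.
have p10 : 0 <= p - 1 by rewrite subr_ge0 ltW.
have p0 : 0 < p by rewrite (lt_trans ltr01).
have lam0 : 0 < lam by exact: lt_le_trans f0 flam.
have max0 x : (0 <= maxe lam%:E (M x))%E by rewrite le_max lee_fin ltW.
set K := (\int[mu]_x _)%E.
have [->|Kfin] := eqVneq K +oo%E; first by rewrite addye// leey.
have K0 : (0 <= K)%E by apply: integral_ge0 => x _; exact: poweR_ge0.
have KE : K = (fine K)%:E by rewrite fineK// ge0_fin_numE// ltey.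
(* A bound for int L_m^(p-1) phi that does not depend on m. *)
pose b : R := (fine K + kap * (lam `^ (p - 1) * f) - lam `^ p) / kap.
have Bb m : (\int[mu]_x (runmax m x `^ (p - 1) * phi x)%:E <= b%:E)%E.
  have : (\int[mu]_x (runmax m x `^ p)%:E <= K)%E.
    apply: ge0_le_integral => //.
    - by move=> x _; rewrite lee_fin powR_ge0.
    - exact: powR_integrand_measurable.
    - apply: (measurableT_comp (measurable_poweR _)).
      by apply: measurable_maxe => //; exact: measurable_maximal.
    - move=> x _; rewrite -poweR_EFin; apply: gt0_ler_poweR; first exact: ltW.
      + by rewrite in_itv/= lee_fin ltW ?runmax_gt0// leey.
      + by rewrite in_itv/= max0 leey.
      + exact: runmax_maximal.
  move: (runmax_energy m); rewrite KE.
  rewrite -(fineK (runmax_powR_int_fin m)) -(fineK (runmax_phi_int_fin m)).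
  move: (fine _) (fine _) => a c.
  rewrite -!EFinM -!EFinD !lee_fin /b ler_pdivlMr//; lra.
have Fb : (F%:E <= b%:E)%E.
  rewrite -phi_F.
  apply: (@le_trans _ _ (\int[mu]_x
    limn (fun m => (runmax m x `^ (p - 1) * phi x)%:E))%E).
    apply: ae_ge0_le_integral => //.
    - by move=> x _; rewrite lee_fin powR_ge0.
    - by apply/measurable_EFinP; exact: (measurableT_comp (measurable_powR _)).
    - move=> x _; apply: lime_ge.
        exact: ereal_nondecreasing_is_cvgn (integrand_homo x p10).
      by apply: nearW => m; rewrite lee_fin mulr_ge0// powR_ge0.
    - apply: (emeasurable_fun_cvg (fun m x => (runmax m x `^ (p - 1) * phi x)%:E)).
        by move=> m; exact: integrand_measurable.
      by move=> x _; exact: ereal_nondecreasing_is_cvgn (integrand_homo x p10).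
    - exact: integrand_limit_ge.
  rewrite monotone_convergence//.
  - apply: lime_le.
      apply: ereal_nondecreasing_is_cvgn => m n mn; apply: ge0_le_integral => //.
      + by move=> x _; rewrite lee_fin mulr_ge0// powR_ge0.
      + exact: integrand_measurable.
      + exact: integrand_measurable.
      + by move=> x _; exact: integrand_homo.
    exact: nearW.
  - by move=> m; exact: integrand_measurable.
  - by move=> m x _; rewrite lee_fin mulr_ge0// powR_ge0.
  - by move=> x _ m n mn; exact: integrand_homo.
move: Fb; rewrite KE -EFinD !lee_fin /b ler_pdivlMr//; lra.
Qed.

Lemma maximal_ge_mean x : (f%:E <= M x)%E.
Proof. by rewrite -(avg0 x); exact: avg_maximal. Qed.

End tree_geometry.

Lemma homogeneous_tree_maximal (R : realType) (d : measure_display)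
    (X : measurableType d) (mu : probability X R) (N : nat) (T : set (set X))
    (p F f : R) (phi : X -> R) :
  (1 < N)%N -> homogeneous_tree mu N T -> 1 < p -> 0 < f ->
  measurable_fun [set: X] phi -> (forall x, 0 <= phi x) ->
  (\int[mu]_x (phi x)%:E = f%:E)%E ->
  (\int[mu]_x (phi x `^ p)%:E = F%:E)%E ->
  [/\ measurable_fun [set: X] (maximal_op mu T phi),
      forall x, (f%:E <= maximal_op mu T phi x)%E &
      forall lam, f <= lam ->
        ((kappa N p * F + lam `^ p)%:E <=
         \int[mu]_x (maxe lam%:E (maximal_op mu T phi x) `^ p) +
         (kappa N p * (lam `^ (p - 1) * f))%:E)%E].
Proof.
move=> N1 [mT _ [C [HC TE lev_diff]]] p1 f0 mphi phi0 phi_f phi_F.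
have Cc I : T I -> (C I #= `I_N)%card by move=> /HC[].
have Cm I J : T I -> C I J -> mu J = ((N%:R^-1)%:E * mu I)%E.
  by move=> /HC[_ _ + _ _]; exact.
have Ct I : T I -> trivIset (C I) id by move=> /HC[].
have CI I : T I -> I = \bigcup_(J in C I) J by move=> /HC[].
split.
- exact: (measurable_maximal N1 mT Cc Cm Ct CI TE mphi phi0 phi_f).
- exact: (maximal_ge_mean N1 mT Cm Ct CI TE mphi phi0 phi_f).
- move=> lam flam.
  apply: (maximal_energy N1 mT Cc Cm Ct CI TE mphi phi0 phi_f p1 f0 flam
    _ _ phi_F lev_diff).
  + by rewrite (lt_trans ltr01)// kappa_gt1.
  + by move=> a y; exact: jump_cost.
Qed.

(** * The weak norm on level sets *)

Lemma weak_norm_ge (R : realType) (d : measure_display) (X : measurableType d)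
    (mu : probability X R) (p q : R) (g : X -> \bar R) (E : set X) :
  measurable E -> (0 < mu E)%E -> (forall x, 0 <= g x)%E ->
  ((fine (mu E) `^ (- p^-1 + q^-1))%:E *
     (\int[mu]_(x in E) (g x `^ p)) `^ p^-1 <= weak_norm mu p q g)%E.
Proof.
move=> mE E0 g0; apply: ereal_sup_ubound; exists E => //.
by under eq_integral do rewrite gee0_abs//.
Qed.

(** The hypothesis says w <= A^p D^(1-p/q), and A^p D^(1-p/q) is lam^p times a
    weighted geometric mean of (A / lam)^q and D. *)
Lemma level_set_young (R : realType) (p q A lam D w : R) :
  1 < p -> p < q -> 0 < lam -> 0 <= A -> 0 < D -> 0 <= w ->
  D `^ (- p^-1 + q^-1) * w `^ p^-1 <= A ->
  w <= lam `^ p * (p / q * (A / lam) `^ q + (1 - p / q) * D).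
Proof.
move=> p1 pq lam0 A0 D0 w0 H.
have p0 : 0 < p by lra.
have q0 : 0 < q by lra.
have Al0 : 0 <= A / lam by rewrite divr_ge0// ltW.
have Hp : (D `^ (- p^-1 + q^-1) * w `^ p^-1) `^ p <= A `^ p.
  by apply: ge0_ler_powR; rewrite ?nnegrE ?mulr_ge0 ?powR_ge0// ltW.
move: Hp; rewrite powRM ?powR_ge0// -!powRrM mulVf ?gt_eqF// powRr1// => Hp.
have wA : w <= D `^ (1 - p / q) * A `^ p.
  have -> : w = D `^ (1 - p / q) * (D `^ ((- p^-1 + q^-1) * p) * w).
    rewrite mulrA -powRD; last by rewrite (gt_eqF D0) implybT.
    rewrite [X in _ `^ X](_ : _ = 0) ?powRr0 ?mul1r//; field; lra.
  by rewrite ler_wpM2l// powR_ge0.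
apply: (le_trans wA).
have -> : A `^ p = lam `^ p * ((A / lam) `^ q) `^ (p / q).
  have -> : ((A / lam) `^ q) `^ (p / q) = (A / lam) `^ p.
    by rewrite -powRrM; congr powR; field; lra.
  by rewrite -powRM ?(ltW lam0)// mulrC divfK// gt_eqF.
rewrite mulrCA ler_pM2l ?powR_gt0// mulrC.
apply: weighted_AMGM; rewrite ?powR_ge0 ?(ltW D0)//.
by rewrite divr_gt0//= ltr_pdivrMr// mul1r.
Qed.

(** The integral of max(lam, g)^p splits into the integral W of g^p over the set
    where g > lam, of measure D, and lam^p (1 - D). The bound on W has slope at
    most lam^p in D, so the dependence on D may be dropped. *)
Lemma level_set_bound (R : realType) (d : measure_display)
    (X : measurableType d) (mu : probability X R) (p q A lam K c : R)
    (g : X -> \bar R) :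
  1 < p -> p < q -> 0 < lam -> 0 <= A ->
  measurable_fun [set: X] g -> (forall x, 0 <= g x)%E ->
  (weak_norm mu p q g = A%:E)%E ->
  ((K + lam `^ p)%:E <= \int[mu]_x (maxe lam%:E (g x) `^ p) + c%:E)%E ->
  K <= p / q * (lam `^ p * (A / lam) `^ q) + c.
Proof.
move=> p1 pq lam0 A0 mg g0 gA.
have p0 : 0 < p by lra.
have q0 : 0 < q by lra.
pose E := [set x | (lam%:E < g x)%E].
have mE : measurable E.
  rewrite -[E]setTI; apply: emeasurable_fun_o_infty => //.
have mnE : measurable (~` E) by exact: measurableC.
pose D := fine (mu E).
have D01 : 0 <= D <= 1.
  rewrite fine_ge0//=; have := probability_le1 mu mE.
  by rewrite -lee_fin fineK// fin_num_measure.
have DE : mu E = D%:E by rewrite fineK// fin_num_measure.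
pose W := (\int[mu]_(x in E) (g x `^ p))%E.
have W0 : (0 <= W)%E by apply: integral_ge0 => x _; exact: poweR_ge0.
have mgp : measurable_fun [set: X] (fun x => g x `^ p)%E.
  exact: (measurableT_comp (measurable_poweR _)).
have mmax : measurable_fun [set: X] (fun x => maxe lam%:E (g x) `^ p)%E.
  by apply: (measurableT_comp (measurable_poweR _)); exact: measurable_maxe.
have split : (\int[mu]_x (maxe lam%:E (g x) `^ p) = W + (lam `^ p * (1 - D))%:E)%E.
  rewrite -(setvU E) setUC ge0_integral_setU//; last 3 first.
  - by rewrite setUv.
  - by move=> x _; exact: poweR_ge0.
  - by rewrite disj_set2E setICr.
  congr (_ + _)%E.
    by apply: eq_integral => x /set_mem/= Ex; rewrite max_r ?ltW.
  rewrite (eq_integral (cst (lam `^ p)%:E)); last first.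
    move=> x /set_mem/= /negP; rewrite -leNgt => gl; rewrite max_l//.
  rewrite integral_cst// [X in (_ * X)%E]probability_setC// EFinM.
  by rewrite EFinB; congr (_ * (1 - _))%E; exact: DE.
have Wb : (W <= (lam `^ p * (p / q * (A / lam) `^ q + (1 - p / q) * D))%:E)%E.
  have [D0|Dpos] := eqVneq D 0.
    rewrite /W (null_set_integral _ _ _)//; last 2 first.
    - exact: measurable_funTS.
    - by apply: etrans DE _; rewrite D0.
    by rewrite lee_fin D0 mulr0 addr0 !mulr_ge0 ?powR_ge0// ?invr_ge0 ltW.
  have D0 : 0 < D by rewrite lt_neqAle eq_sym Dpos; case/andP: D01.
  have := @weak_norm_ge R d X mu p q g E mE.
  rewrite gA DE lte_fin D0 => /(_ erefl g0); rewrite /= -/W.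
  clear split; clearbody W; move: W0; case: W => [w| |]//; last first.
    by rewrite poweRyr ?invr_eq0 ?gt_eqF// gt0_muley// lte_fin powR_gt0.
  rewrite !lee_fin => w0.
  exact: level_set_young.
rewrite split; clear split; clearbody W; move: W0 Wb; case: W => [w| |]//.
rewrite -!EFinD !lee_fin => w0.
have := powR_gt0 p lam0; have : 0 <= p / q by apply: divr_ge0; exact: ltW.
move: (lam `^ p) ((A / lam) `^ q) (p / q) => l a r r0 l0 Hw.
have [D0 _] := andP D01.
have rlD : 0 <= r * (l * D) by rewrite !mulr_ge0// ltW.
by lra.
Qed.

(** * Comparison of the constants *)

Lemma powR_div (R : realType) (x y r : R) :
  0 <= x -> 0 <= y -> (x / y) `^ r = x `^ r / y `^ r.
Proof.
move=> x0 y0; rewrite powRM ?invr_ge0//; congr (_ * _).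
by rewrite -powR_inv1// -powRrM mulN1r powRN.
Qed.

(** With this choice of [lam] one has k (F - lam^(p-1) f) = k F (p - 1) / (q - 1),
    so the hypothesis bounds A^q = lam^p (A / lam)^q lam^(q-p) from below, and even
    by q times the q-th power of the left side of the conclusion. *)
Lemma critical_level_bound (R : realType) (p q F f A k lam : R) :
  1 < p -> p < q -> 0 < F -> 0 < f -> 0 < k -> 0 <= A -> 0 < lam ->
  lam `^ (p - 1) = (q - p) * F / ((q - 1) * f) ->
  k * F <= p / q * (lam `^ p * (A / lam) `^ q) + k * (lam `^ (p - 1) * f) ->
  ((p - 1) / p * k) `^ q^-1 *
    ((q - p) `^ ((q - p) / (q * (p - 1))) /
     (q - 1) `^ ((q - 1) / (q * (p - 1)))) *
    (F `^ ((q - 1) / (p - 1)) / f `^ ((q - p) / (p - 1))) `^ q^-1 <= A.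
Proof.
move=> p1 pq F0 f0 k0 A0 lam0 lamE H.
have p0 : 0 < p by lra.
have q0 : 0 < q by lra.
have qp : 0 < q - p by lra.
have q1 : 0 < q - 1 by lra.
pose s := (q - p) / (p - 1).
pose c := (p - 1) / p * k.
have c0 : 0 < c by apply: mulr_gt0 => //; apply: divr_gt0; lra.
pose Y := lam `^ p * (A / lam) `^ q.
have lams : lam `^ (q - p) = ((q - p) / (q - 1)) `^ s * (F / f) `^ s.
  rewrite [X in lam `^ X](_ : q - p = (p - 1) * s); last by rewrite /s; field; lra.
  have d0 : 0 <= (q - p) / (q - 1) by apply: divr_ge0; exact: ltW.
  have d1 : 0 <= F / f by apply: divr_ge0; exact: ltW.
  by rewrite powRrM lamE -powRM// mulf_div.
have AqE : A `^ q = Y * lam `^ (q - p).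
  have {1}-> : A = A / lam * lam by rewrite divfK// gt_eqF.
  rewrite powRM ?divr_ge0 ?(ltW lam0)//.
  have -> : lam `^ q = lam `^ p * lam `^ (q - p).
    by rewrite -powRD ?subrKC// (gt_eqF lam0) implybT.
  by rewrite /Y; ring.
have YF : c * (F / (q - 1)) <= Y.
  move: H; rewrite lamE -/Y => H.
  have H2 : k * (F * (p - 1) / (q - 1)) <= p / q * Y.
    have E : k * ((q - p) * F / ((q - 1) * f) * f) = k * ((q - p) * F / (q - 1)).
      by field; apply/andP; split; lra.
    rewrite E in H.
    have -> : k * (F * (p - 1) / (q - 1)) = k * F - k * ((q - p) * F / (q - 1)).
      by field; lra.
    lra.
  (* The factor q > 1 is discarded below. *)
  have H3 : q * (c * (F / (q - 1))) <= Y.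
    have -> : q * (c * (F / (q - 1))) = q / p * (k * (F * (p - 1) / (q - 1))).
      by rewrite /c; field; apply/andP; split; lra.
    have -> : Y = q / p * (p / q * Y) by field; apply/andP; split; lra.
    by rewrite ler_wpM2l// divr_ge0// ltW.
  have z0 : 0 <= c * (F / (q - 1)).
    by apply: mulr_ge0; [exact: ltW|apply: divr_ge0; exact: ltW].
  by apply: le_trans H3; apply: ler_peMl => //; lra.
have target : c * (F / (q - 1)) * lam `^ (q - p) <= A `^ q.
  by rewrite AqE ler_wpM2r// powR_ge0.
have s1 : (q - 1) / (p - 1) = s + 1 by rewrite /s; field; lra.
have -> : (q - p) / (q * (p - 1)) = s * q^-1.
  by rewrite /s; field; apply/andP; split; lra.
have -> : (q - 1) / (q * (p - 1)) = (s + 1) * q^-1.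
  by rewrite /s; field; apply/andP; split; lra.
rewrite s1 -/s -/c; clearbody s; rewrite !powRrM -powR_div ?powR_ge0//.
have pow1 x : 0 < x -> x `^ (s + 1) = x `^ s * x.
  by move=> x0; rewrite powRD ?(gt_eqF x0) ?implybT// powRr1// ltW.
have c0w := ltW c0.
have D (x y r t : R) : 0 <= x `^ r / y `^ t by rewrite divr_ge0 ?powR_ge0.
have cD (x y r t : R) : 0 <= c * (x `^ r / y `^ t) by apply: mulr_ge0.
rewrite -!powRM//.
have -> : A = (A `^ q) `^ q^-1 by rewrite -powRrM divff ?gt_eqF// powRr1.
apply: ge0_ler_powR.
- by rewrite invr_ge0 ltW.
- by rewrite nnegrE; exact: mulr_ge0.
- by rewrite nnegrE powR_ge0.
apply: le_trans target; rewrite le_eqVlt; apply/orP; left; apply/eqP.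
rewrite lams !powR_div ?(ltW qp) ?(ltW q1) ?(ltW F0) ?(ltW f0)// !pow1//.
have Q : (q - 1) `^ s != 0 by rewrite gt_eqF// powR_gt0.
have G : f `^ s != 0 by rewrite gt_eqF// powR_gt0.
field.
rewrite Q G /=; lra.
Qed.

(** Raised to the power p and multiplied by p - 1, this is [powR_mean_bound] at
    u = f^p; the last hypothesis is its condition (q - p) F <= (q - 1) u. *)
Lemma mean_bound_dominates (R : realType) (p q F f k : R) :
  1 < p -> p < q -> 0 < F -> 0 < k -> (p - 1) / p * k <= 1 ->
  0 < f -> f `^ p <= F ->
  1 <= (q - 1) / (q - p) * (f `^ p / F) ->
  ((p - 1) / p * k) `^ q^-1 * (p / (p - 1)) `^ p^-1 *
    (F - f `^ p / p) `^ p^-1 <= (f `^ p + k * (F - f `^ p)) `^ p^-1.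
Proof.
move=> p1 pq F0 k0 c1 f0 fF cond.
have p0 : 0 < p by lra.
have q0 : 0 < q by lra.
have c0 : 0 < (p - 1) / p * k by apply: mulr_gt0 => //; apply: divr_gt0; lra.
have u0 := powR_ge0 f p.
have uF : (q - p) * F <= (q - 1) * f `^ p.
  move: cond; rewrite mulf_div ler_pdivlMr ?mul1r//.
  by apply: mulr_gt0 => //; lra.
have := powR_mean_bound p1 pq c0 c1 u0 fF uF.
set u := f `^ p in u0 uF fF *; set c := (p - 1) / p * k => H.
have Fu : 0 <= F - u / p.
  rewrite subr_ge0 ler_pdivrMr//; nra.
have -> : c `^ q^-1 = (c `^ (p / q)) `^ p^-1.
  by rewrite -powRrM; congr powR; field; apply/andP; split; lra.
have pp : 0 <= p / (p - 1) by apply: divr_ge0; lra.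
have epp : 0 <= c `^ (p / q) * (p / (p - 1)) by rewrite mulr_ge0 ?powR_ge0.
rewrite -!powRM ?powR_ge0//.
apply: ge0_ler_powR.
- by rewrite invr_ge0 ltW.
- by rewrite nnegrE; exact: mulr_ge0.
- rewrite nnegrE; apply: addr_ge0 => //.
  by apply: mulr_ge0; [exact: ltW|rewrite subr_ge0].
have p10 : 0 < p - 1 by lra.
rewrite -(ler_pM2l p10).
have -> : (p - 1) * (c `^ (p / q) * (p / (p - 1)) * (F - u / p)) =
  c `^ (p / q) * (p * F - u) by field; apply/andP; split; lra.
apply: (le_trans H); rewrite /c.
rewrite le_eqVlt; apply/orP; left; apply/eqP; field; lra.
Qed.

(** * The lower bounds *)

Theorem corollary1 (R : realType) (d : measure_display) (X : measurableType d)
    (mu : probability X R) (N : nat) (T : set (set X)) (p q F f : R)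
    (phi : X -> R) :
  (1 < N)%N ->
  nonatomic mu ->
  homogeneous_tree mu N T ->
  1 < p -> p < q ->
  0 < F -> 0 < f -> f `^ p <= F ->
  measurable_fun [set: X] phi ->
  (forall x, 0 <= phi x) ->
  (\int[mu]_x (phi x)%:E = f%:E)%E ->
  (\int[mu]_x (phi x `^ p)%:E = F%:E)%E ->
  ((q - 1) / (q - p) * (f `^ p / F) < 1 ->
    ((Num.max
        (cNp N p `^ q^-1 *
         ((q - p) `^ ((q - p) / (q * (p - 1))) /
          (q - 1) `^ ((q - 1) / (q * (p - 1)))) *
         (F `^ ((q - 1) / (p - 1)) / f `^ ((q - p) / (p - 1))) `^ q^-1)
        ((f `^ p + (N%:R `^ p - 1) / (N%:R `^ p - N%:R) * (F - f `^ p))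
           `^ p^-1))%:E
     <= weak_norm mu p q (maximal_op mu T phi))%E) /\
  (1 <= (q - 1) / (q - p) * (f `^ p / F) ->
    ((Num.max
        (cNp N p `^ q^-1 * (p / (p - 1)) `^ p^-1 *
         (F - f `^ p / p) `^ p^-1)
        ((f `^ p + (N%:R `^ p - 1) / (N%:R `^ p - N%:R) * (F - f `^ p))
           `^ p^-1))%:E
     <= weak_norm mu p q (maximal_op mu T phi))%E).
Proof.
move=> N1 _ treeT p1 pq F0 f0 fF mphi phi0 phi_f phi_F.
have [mM Mf energy] := homogeneous_tree_maximal N1 treeT p1 f0 mphi phi0 phi_f phi_F.
rewrite !cNp_kappa -/(kappa N p).
set M := maximal_op mu T phi in mM Mf energy *.
set k : R := kappa N p in energy *.
have k0 : 0 < k by rewrite (lt_trans ltr01)// kappa_gt1.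
have c1 : (p - 1) / p * k <= 1 by rewrite -cNp_kappa cNp_le1.
clearbody k.
have p0 : 0 < p by lra.
have M0 x : (0 <= M x)%E by apply: le_trans (Mf x); rewrite lee_fin ltW.
have fp1 : f `^ (p - 1) * f = f `^ p by rewrite mulrC mulr_powRB1// ltW.
have mean : (((f `^ p + k * (F - f `^ p)) `^ p^-1)%:E <= weak_norm mu p q M)%E.
  have muT : fine (mu [set: X]) = 1 by rewrite probability_setT.
  have := @weak_norm_ge R d X mu p q M setT measurableT.
  rewrite muT powR1 mul1e => H; apply: le_trans (H _ M0); last first.
    by rewrite probability_setT lte01.
  rewrite -poweR_EFin; apply: gt0_ler_poweR.
  - by rewrite invr_ge0 ltW.
  - rewrite in_itv/= leey andbT lee_fin addr_ge0 ?powR_ge0//.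
    by apply: mulr_ge0; [exact: ltW|rewrite subr_ge0].
  - by rewrite in_itv/= leey andbT; apply: integral_ge0 => x _; exact: poweR_ge0.
  have := energy f (lexx f).
  rewrite (eq_integral (fun x => M x `^ p)%E); last by move=> x _; rewrite max_r.
  case: (\int[mu]_x _)%E => [w| |].
  - by rewrite -EFinD !lee_fin fp1; lra.
  - by rewrite !leey.
  - by rewrite addNye leeNy_eq.
split=> cond; rewrite EFin_max ge_max mean andbT; last first.
  apply: le_trans mean; rewrite lee_fin.
  exact: mean_bound_dominates.
have [->|wfin] := eqVneq (weak_norm mu p q M) +oo%E; first exact: leey.
have w0 : (0 <= weak_norm mu p q M)%E by apply: le_trans mean; rewrite lee_fin powR_ge0.
have wE : (weak_norm mu p q M = (fine (weak_norm mu p q M))%:E)%E.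
  by rewrite fineK// ge0_fin_numE// ltey.
set A := fine _ in wE.
have A0 : 0 <= A by exact: fine_ge0.
rewrite wE lee_fin.
pose z := (q - p) * F / ((q - 1) * f).
have z0 : 0 < z by apply: divr_gt0; apply: mulr_gt0 => //; lra.
pose lam := z `^ (p - 1)^-1.
have lam0 : 0 < lam by rewrite powR_gt0.
have lamE : lam `^ (p - 1) = z.
  by rewrite /lam -powRrM mulVf ?powRr1 ?ltW// gt_eqF//; lra.
(* The hypothesis of case (i) is equivalent to f < lam. *)
have flam : f <= lam.
  rewrite leNgt; apply/negP => lamf.
  have : lam `^ (p - 1) < f `^ (p - 1).
    by apply: gt0_ltr_powR; rewrite ?nnegrE ?(ltW lam0) ?(ltW f0)//; lra.
  rewrite lamE /z ltr_pdivrMr; last by apply: mulr_gt0 => //; lra.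
  rewrite mulrCA fp1; move: cond; rewrite mulf_div ltr_pdivrMr ?mul1r; last first.
    by apply: mulr_gt0 => //; lra.
  lra.
apply: (critical_level_bound p1 pq F0 f0 k0 A0 lam0 lamE).
exact: (level_set_bound p1 pq lam0 A0 mM M0 wE (energy lam flam)).
Qed.
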